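(* Let $H$ be the Hamiltonian with the preferred-orientation coupling at every vertex of the equilateral metric graph formed by the vertices and edges of the regular icosahedron, all edges having length $1$. Then the square roots $k$ of the eigenvalues $k^2$ of $H$ are, for large $k$, placed in the intervals $$\left(n\pi-\frac{10.84}{k}+\mathcal O\!\left(\frac1{k^2}\right),\; n\pi+\frac{10.84}{k}+\mathcal O\!\left(\frac1{k^2}\right)\right),\qquad n\in\mathbb Z .$$ That is, there exist constants $C,K>0$ such that for every $k\ge K$ for which $k^2$ is an eigenvalue of $H$ there is $n\in\mathbb Z$ with $$|k-n\pi|<\frac{10.84}{k}+\frac{C}{k^2}.$$
   Context: Graph: the metric graph whose vertices and edges are those of the given Platonic solid in $\mathbb R^3$; each of its $N$ edges is identified with the interval $(0,1)$ (the choice of direction of the identification is immaterial). Operator: $H$ acts on $\bigoplus_{e=1}^N L^2((0,1))$ as $f_e\mapsto -f_e''$ on every edge. Its domain consists of all functions in $\bigoplus_{e=1}^N W^{2,2}((0,1))$ satisfying, at every vertex $v$, the coupling condition $$(U_v-I)\Psi_v+i(U_v+I)\Psi_v'=0,$$ where $\Psi_v\in\mathbb C^d$ is the vector of boundary values at $v$ of the functions on the $d$ edges meeting at $v$ ($d$ is the degree of $v$), and $\Psi_v'\in\mathbb C^d$ is the vector of the corresponding outgoing derivatives, i.e. $f'(0)$ if $v$ corresponds to the endpoint $x=0$ of the edge, and $-f'(1)$ if $v$ corresponds to the endpoint $x=1$. Preferred-orientation coupling: at every vertex the edges are numbered $1,\dots,d$ consecutively in the clockwise cyclic order as seen from the exterior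 of the solid, and $U_v$ is the $d\times d$ cyclic permutation matrix with $(U_v)_{m,m+1}=1$ for $m=1,\dots,d-1$, $(U_v)_{d,1}=1$, and all other entries $0$. Explicitly, with cyclic indices, the coupling condition reads $\psi_{m+1}-\psi_m+i(\psi'_{m+1}+\psi'_m)=0$ for $m=1,\dots,d$. The operator $H$ is self-adjoint with purely discrete spectrum. Only positive eigenvalues $k^2$ with $k>0$ are considered. *)

(* Defs.v *)
From mathcomp Require Import all_boot all_order all_algebra.
From mathcomp Require Import complex.
From mathcomp Require Import all_classical all_reals all_analysis.

Set Implicit Arguments.
Unset Strict Implicit.
Unset Printing Implicit Defensive.

Import Order.TTheory GRing.Theory Num.Theory.
Import numFieldNormedType.Exports.

Local Open Scope ring_scope.

(* The vertices of the regular icosahedron with edge length 1 centred at the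
   origin are the cyclic permutations of (0, +-1/2, +-phi/2), with phi the
   golden ratio.  The triple (c, s, t) stands for the vertex whose coordinate
   number c vanishes; s and t give the signs of the next two coordinates
   (cyclically), true meaning +. *)
Notation vertex := ('I_3 * bool * bool)%type.

Section Icosahedron.
Variable R : realType.

Definition golden : R := (1 + Num.sqrt 5) / 2.

Definition position (v : vertex) : 'rV[R]_3 :=
  let: (c, s, t) := v in
  \row_j (if j == c then 0
          else if j == c + 1 then (-1) ^+ (~~ s) / 2
          else (-1) ^+ (~~ t) * golden / 2).

Definition eucl_dist (p q : 'rV[R]_3) : R :=
  Num.sqrt (\sum_j (p ord0 j - q ord0 j) ^+ 2).

Definition adjacent_vertices (v w : vertex) : bool :=
  eucl_dist (position v) (position w) == 1.

Definition is_edge (e : {set vertex}) : bool :=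
  [exists v, exists w, adjacent_vertices v w && (e == [set v; w])].

Definition edge : Type := {e : {set vertex} | is_edge e}.

Definition incident (v : vertex) (e : edge) : bool := v \in val e.

Definition triple_product (a b c : 'rV[R]_3) : R :=
  \det (col_mx a (col_mx b c) : 'M[R]_3).

(* [e'] comes immediately after [e] in the clockwise order around [v] as seen
   from the exterior.  Two edges vw and vw' are consecutive around v when they
   bound a common face, i.e. when v, w, w' form a triangle.  The outward
   direction at v is [position v], and the turn from w to w' about this axis is
   counterclockwise for an exterior observer when (v, w, w') is positively
   oriented, hence clockwise when the determinant is negative. *)
Definition clockwise_next (v : vertex) (e e' : edge) : Prop :=
  exists w w' : vertex,
    [/\ val e = [set v; w], val e' = [set v; w'], adjacent_vertices w w' &
        triple_product (position v) (position w) (position w') < 0].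

(* [num v] numbers the five edges at [v]; ['I_5] starts at 0, and [ordS] is
   the cyclic successor. *)
Definition clockwise_numbering (num : vertex -> 'I_5 -> edge) : Prop :=
  forall v, [/\ injective (num v),
    (forall e, incident v e <-> exists m, num v m = e) &
    forall m, clockwise_next v (num v m) (num v (ordS m))].

End Icosahedron.

Section Hamiltonian.
Variable R : realType.
Local Open Scope classical_set_scope.
Local Open Scope complex_scope.
Local Notation mu := (@lebesgue_measure R).
Local Notation I01 := (`]0, 1[ : set R).

Definition in_L2 (h : R -> R[i]) : Prop :=
  [/\ measurable_fun I01 (fun x => complex.Re (h x)),
      measurable_fun I01 (fun x => complex.Im (h x)) &
      mu.-integrable I01
        (fun x => (complex.Re (h x) ^+ 2 + complex.Im (h x) ^+ 2)%:E)].

Definition integral0 (g : R -> R[i]) (x : R) : R[i] :=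
  Rintegral mu `]0, x[ (fun t => complex.Re (g t)) +i*
  Rintegral mu `]0, x[ (fun t => complex.Im (g t)).

(* [f] is the representative, absolutely continuous on [0, 1], of a function
   in W^{1,2}((0,1)) whose weak derivative is [g]; values of [f] and [g]
   outside [0, 1] play no role. *)
Definition in_W12 (f g : R -> R[i]) : Prop :=
  in_L2 g /\ forall x, 0 <= x <= 1 -> f x = f 0 + integral0 g x.

(* W^{2,2}: [f'] is the continuous representative of the derivative, so that
   its values at the endpoints are the boundary values of the derivative. *)
Definition in_W22 (f f' f'' : R -> R[i]) : Prop :=
  in_W12 f f' /\ in_W12 f' f''.

Definition ae_eq01 (f g : R -> R[i]) : Prop :=
  {ae mu, forall x, I01 x -> f x = g x}.

(* The edge [e] is identified with (0,1) so that x = 0 corresponds to the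
   endpoint [src e]. *)
Definition orientation (src : edge R -> vertex) : Prop :=
  forall e, incident (src e) e.

Definition boundary_value (src : edge R -> vertex) (f : edge R -> R -> R[i])
    (v : vertex) (e : edge R) : R[i] :=
  if src e == v then f e 0 else f e 1.

Definition outgoing_derivative (src : edge R -> vertex)
    (f' : edge R -> R -> R[i]) (v : vertex) (e : edge R) : R[i] :=
  if src e == v then f' e 0 else - f' e 1.

Definition cyclic_matrix (d : nat) : 'M[R[i]]_d :=
  \matrix_(m, n) (n == ordS m)%:R.

Definition vertex_condition (d : nat) (U : 'M[R[i]]_d)
    (psi psi' : 'cV[R[i]]_d) : Prop :=
  (U - 1%:M) *m psi + 'i *: ((U + 1%:M) *m psi') = 0.

Definition preferred_orientation_coupling (src : edge R -> vertex)
    (num : vertex -> 'I_5 -> edge R) (f f' : edge R -> R -> R[i]) : Prop :=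
  forall v, vertex_condition (cyclic_matrix 5)
    (\col_m boundary_value src f v (num v m))
    (\col_m outgoing_derivative src f' v (num v m)).

(* [hamiltonian src num f g] : the class of [f] is in the domain of H and H
   maps it to the class of [g]. *)
Definition hamiltonian (src : edge R -> vertex)
    (num : vertex -> 'I_5 -> edge R) (f g : edge R -> R -> R[i]) : Prop :=
  exists u u' u'' : edge R -> R -> R[i],
    [/\ forall e, ae_eq01 (f e) (u e),
        forall e, in_W22 (u e) (u' e) (u'' e),
        preferred_orientation_coupling src num u u' &
        forall e, ae_eq01 (g e) (fun x => - u'' e x)].

Definition eigenvalue_of_H (src : edge R -> vertex)
    (num : vertex -> 'I_5 -> edge R) (lambda : R[i]) : Prop :=
  exists f : edge R -> R -> R[i],
    (~ forall e, ae_eq01 (f e) (fun=> 0)) /\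
    hamiltonian src num f (fun e x => lambda * f e x).

End Hamiltonian.

(* Main.v *)
Require Import Defs.
From mathcomp Require Import all_boot all_order all_algebra.
From mathcomp Require Import complex ring lra.
From mathcomp Require Import all_classical all_reals all_analysis.
From mathcomp Require Import measurable_realfun.
Import Order.TTheory GRing.Theory Num.Theory.
Import numFieldNormedType.Exports.
Local Open Scope ring_scope.
Local Open Scope complex_scope.

(* At a vertex of odd degree 5 the coupling condition can be solved for the
   outgoing derivatives:
   psi'_m = i (psi_(m+1) - psi_(m+2) + psi_(m+3) - psi_(m+4)).
   They are thus bounded by 4 M, with M the largest modulus of a boundary value.
   On an edge with boundary values p, q and outgoing derivatives P, Q,
   -f'' = k^2 f gives k (q - p cos k) = P sin k and k (p - q cos k) = Q sin k,
   hence k p sin k = Q + P cos k when sin k <> 0.  Choosing the end of an edge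
   where |p| = M yields k |sin k| <= 4 (1 + |cos k|), that is,
   tan (d / 2) <= 4 / k for the distance d from k to the nearest multiple of pi.
   Thus d <= 8 / k, and 8 < 10.84. *)

(** * Regularity and explicit solution of the eigenvalue equation on one edge *)

Section EdgeEquation.
Variable R : realType.
Local Open Scope classical_set_scope.
Local Notation mu := (@lebesgue_measure R).
Local Notation I01 := (`]0, 1[ : set R).

Lemma integrable_itvoo_cc (a b : R) (f : R -> R) :
  mu.-integrable `]a, b[ (EFin \o f) -> mu.-integrable `[a, b] (EFin \o f).
Proof.
move=> /integrableP[mf fi].
have mf' : measurable_fun `]a, b[ f by exact/measurable_EFinP.
apply/integrableP; split.
  by apply/measurable_EFinP; exact: measurable_fun_itv_cc mf'.
by rewrite integral_itv_bndoo//; exact: measurableT_comp.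
Qed.

(** The integral identity of [in_W12] for a real or an imaginary part, so that the real fundamental
    theorem of calculus applies. *)
Definition primitive01 (a b : R -> R) :=
 forall x : R, 0 <= x <= 1 -> a x = a 0 + \int[mu]_(t in `]0, x[) b t.

Lemma primitive01E {a b : R -> R} : mu.-integrable `[0, 1] (EFin \o b) ->
  primitive01 a b ->
  forall x : R, 0 <= x <= 1 -> a x = a 0 + \int[mu]_(t in `[0, x]) b t.
Proof.
move=> bi ab x x01; rewrite (ab x x01); congr (_ + _).
have /andP[x0 x1] := x01.
rewrite Rintegral_itv_bndo_bndc ?Rintegral_itv_obnd_cbnd//.
  by apply: integrableS bi => //; apply: subset_itvScc; rewrite bnd_simp.
by apply: integrableS bi => //; apply: subset_itvScc; rewrite bnd_simp.
Qed.

Lemma primitive01_continuous {a b : R -> R} :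
  mu.-integrable `[0, 1] (EFin \o b) ->
  primitive01 a b -> {within `[0, 1], continuous a}.
Proof.
move=> bi ab.
apply: (@subspace_eq_continuous _ _ _
  (fun x => a 0 + parameterized_integral mu 0 x b)).
  move=> x /set_mem /=; rewrite in_itv => x01.
  by rewrite /from_subspace [RHS](primitive01E bi ab).
have intc := parameterized_integral_continuous ler01 bi.
by move=> x; apply: cvgD; [exact: cvg_cst|exact: intc].
Qed.

(** Continuity of the integrand turns the weak derivative into a classical one at interior
    points. *)
Lemma primitive01_derive {a b : R -> R} : {within `[0, 1], continuous b} ->
  primitive01 a b -> forall x : R, x \in `]0, 1[%R -> is_derive x 1 a (b x).
Proof.
move=> bc ab x x01.
have bi : mu.-integrable `[0, 1] (EFin \o b).
  by apply: continuous_compact_integrable => //; exact: segment_compact.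
have [x0 x1] : 0 < x /\ x < 1 by rewrite !(itvP x01).
have bx := within_continuous_continuous ltr01 bc x01.
have [dF FE] := continuous_FTC1_closed x1 bi x0 bx.
have : is_derive x 1 (fun x => a 0 + \int[mu]_(t in `[0, x]) b t) (b x).
  rewrite -[b x]add0r; apply: is_deriveD.
  by apply: DeriveDef => //; rewrite -derive1E.
(* The integral formula for [a] holds on [0, 1] only, so it is used on a neighbourhood of [x] inside
   ]0, 1[. *)
apply: near_eq_is_derive; near=> z; rewrite -(primitive01E bi ab)//.
suff : z \in `]0, 1[%R by rewrite in_itv/= => /andP[/ltW-> /ltW].
near: z; exact: near_in_itvoo x01.
Unshelve. all: by end_near. Qed.

Lemma derive0_cst01 (f : R -> R) : {within `[0, 1], continuous f} ->
  (forall x : R, x \in `]0, 1[%R -> is_derive x 1 f 0) ->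
  forall x : R, 0 <= x <= 1 -> f x = f 0.
Proof.
move=> fc df x /andP[]; rewrite le_eqVlt => /predU1P[<-//|x0 x1].
have [| |c _] := @MVT _ f (cst 0) 0 x x0.
- move=> y yx; apply: df; move: yx.
  by rewrite !in_itv/= => /andP[-> /lt_le_trans]; exact.
- by apply: continuous_subspaceW fc; apply: subset_itvScc; rewrite bnd_simp.
- by rewrite mul0r => /subr0_eq.
Qed.

(** Rotating the vector [(a y, b y / k)] by the angle [k * y] gives a pair [(A y, B y)] with zero
    derivative; undoing the rotation yields the formulas. *)
Lemma helmholtz01 (k : R) (a b : R -> R) : k != 0 ->
  {within `[0, 1], continuous a} -> {within `[0, 1], continuous b} ->
  (forall x : R, x \in `]0, 1[%R -> is_derive x 1 a (b x)) ->
  (forall x : R, x \in `]0, 1[%R -> is_derive x 1 b (- k ^+ 2 * a x)) ->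
  forall x : R, 0 <= x <= 1 ->
    a x = a 0 * cos (k * x) + b 0 / k * sin (k * x) /\
    b x = b 0 * cos (k * x) - k * a 0 * sin (k * x).
Proof.
move=> k0 ac bc da db x x01.
have cc : {within `[0, 1], continuous (fun y => cos (k * y))}.
  apply: continuous_subspaceT => y.
  apply: continuous_comp; last exact: continuous_cos.
  exact: mulrl_continuous.
have sc : {within `[0, 1], continuous (fun y => sin (k * y))}.
  apply: continuous_subspaceT => y.
  apply: continuous_comp; last exact: continuous_sin.
  exact: mulrl_continuous.
have bkc : {within `[0, 1], continuous (fun y => k^-1 * b y)}.
  by move=> y; apply: cvgM; [exact: cvg_cst|exact: bc].
pose A y := a y * cos (k * y) - k^-1 * b y * sin (k * y).
pose B y := a y * sin (k * y) + k^-1 * b y * cos (k * y).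
have dk (y : R) : is_derive y 1 (fun z => k * z) k.
  by apply: is_derive_eq; rewrite /GRing.scale/= mulr1.
have dcos (y : R) : is_derive y 1 (fun z => cos (k * z)) (- (k * sin (k * y))).
  apply: is_derive_eq (is_derive1_comp _ _) _; rewrite /GRing.scale/=; ring.
have dsin (y : R) : is_derive y 1 (fun z => sin (k * z)) (k * cos (k * y)).
  apply: is_derive_eq (is_derive1_comp _ _) _; rewrite /GRing.scale/=; ring.
have AE : A x = A 0.
  apply: derive0_cst01 => // [|y y01].
    by move=> y; apply: cvgB; apply: cvgM;
      [exact: ac|exact: cc|exact: bkc|exact: sc].
  have := da y y01; have := db y y01 => ? ?.
  apply: is_derive_eq; rewrite /GRing.scale/=; field.
  exact: k0.
have BE : B x = B 0.
  apply: derive0_cst01 => // [|y y01].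
    by move=> y; apply: cvgD; apply: cvgM;
      [exact: ac|exact: sc|exact: bkc|exact: cc].
  have := da y y01; have := db y y01 => ? ?.
  apply: is_derive_eq; rewrite /GRing.scale/=; field.
  exact: k0.
move: AE BE; rewrite /A /B mulr0 sin0 cos0 => AE BE.
have cs := cos2Dsin2 (k * x).
set c := cos _ in AE BE cs *; set s := sin _ in AE BE cs *.
(* The initial values are expressed by the values at [x] and put into the goal, which then reduces
   to [c ^+ 2 + s ^+ 2 = 1]. *)
have a0E : a 0 = a x * c - k^-1 * b x * s by rewrite AE; ring.
have b0E : b 0 = k * (a x * s + k^-1 * b x * c) by rewrite BE; field.
split; rewrite a0E b0E.
  transitivity (a x * (c ^+ 2 + s ^+ 2)); first by rewrite cs mulr1.
  by field.
transitivity (b x * (c ^+ 2 + s ^+ 2)); first by rewrite cs mulr1.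
by field.
Qed.


(** Square integrability implies integrability on an interval of finite length: expanding
    [(f x - 1) ^+ 2] and [(f x + 1) ^+ 2] gives [|f x| <= 1 + f x ^+ 2 <= 1 + g x]. *)
Lemma integrable_of_sqr01 (f g : R -> R) : measurable_fun I01 f ->
  mu.-integrable `]0, 1[ (EFin \o g) ->
  (forall x, f x ^+ 2 <= g x) -> mu.-integrable `]0, 1[ (EFin \o f).
Proof.
move=> mf gi fg.
have ci : mu.-integrable `]0, 1[ (EFin \o cst 1).
  apply: measurable_bounded_integrable => //.
    have /= -> := @lebesgue_measure_itv R `]0, 1[%R.
    by rewrite lte_fin ltr01 oppr0 adde0 ltry.
  by exists 1; split=> // M M1 x _ /=; rewrite normr1 ltW.
apply: le_integrable (integrableD _ ci gi) => //; first exact/measurable_EFinP.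
move=> x _ /=; rewrite lee_fin.
have := fg x; have := sqr_ge0 (f x - 1); have := sqr_ge0 (f x + 1).
rewrite !expr2 => h1 h2 h3.
by rewrite [leRHS]ger0_norm ?ler_norml; first (apply/andP; split); nra.
Qed.

(** The equation for [c] holds only almost everywhere, but [c] enters only under an integral. Hence
    [b] is also a primitive of the continuous function [- k ^+ 2 * a], and the equation holds
    classically. *)
Lemma edge_ode_real {k : R} {a b c : R -> R} : k != 0 ->
  mu.-integrable `]0, 1[ (EFin \o b) -> mu.-integrable `]0, 1[ (EFin \o c) ->
  primitive01 a b -> primitive01 b c ->
  {ae mu, forall x, I01 x -> c x = - k ^+ 2 * a x} ->
  forall x : R, 0 <= x <= 1 ->
    a x = a 0 * cos (k * x) + b 0 / k * sin (k * x) /\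
    b x = b 0 * cos (k * x) - k * a 0 * sin (k * x).
Proof.
move=> k0 /integrable_itvoo_cc bi /integrable_itvoo_cc ci ab bc caE.
have ac := primitive01_continuous bi ab.
have bcont := primitive01_continuous ci bc.
have kac : {within `[0, 1], continuous (fun y => - k ^+ 2 * a y)}.
  by move=> y; apply: cvgM; [exact: cvg_cst|exact: ac].
have mc : measurable_fun (`[0, 1] : set R) c.
  by apply/measurable_EFinP; exact: measurable_int ci.
have mka : measurable_fun (`[0, 1] : set R) (fun y => - k ^+ 2 * a y).
  by apply: subspace_continuous_measurable_fun.
have bka : primitive01 b (fun y => - k ^+ 2 * a y).
  move=> x x01; rewrite (bc x x01) /Rintegral; congr (_ + fine _).
  have sub : `]0, x[ `<=` `]0, 1[.
    by apply: subset_itvl; rewrite bnd_simp; case/andP: x01.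
  have sub' : `]0, x[ `<=` `[0, 1] by move=> y /sub; exact: subset_itv_oo_cc.
  apply: ae_eq_integral => //.
  - by apply/measurable_EFinP; apply: measurable_funS mc.
  - by apply/measurable_EFinP; apply: measurable_funS mka.
  - apply: (@filterS _ _ (ae_filter_ringOfSetsType mu)) caE => y cay /sub y01.
    by rewrite cay.
apply: helmholtz01 => //.
- exact: primitive01_derive.
- exact: primitive01_derive.
Qed.

Lemma in_L2_integrable {g : R -> R[i]} : in_L2 g ->
  mu.-integrable `]0, 1[ (EFin \o (fun x => complex.Re (g x))) /\
  mu.-integrable `]0, 1[ (EFin \o (fun x => complex.Im (g x))).
Proof.
move=> [mr mi gi]; split; apply: integrable_of_sqr01 gi _ => // x.
  by rewrite lerDl sqr_ge0.
by rewrite lerDr sqr_ge0.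
Qed.

Lemma in_W12_primitive01 {f g : R -> R[i]} : in_W12 f g ->
  primitive01 (fun x => complex.Re (f x)) (fun x => complex.Re (g x)) /\
  primitive01 (fun x => complex.Im (f x)) (fun x => complex.Im (g x)).
Proof.
by move=> [_ fg]; split=> x /fg ->; rewrite /integral0; case: (f 0).
Qed.

(** Since [k ^+ 2] is real, the real and imaginary parts solve the real equation separately. *)
Lemma edge_ode (k : R) (f u u' u'' : R -> R[i]) : k != 0 ->
  in_W22 u u' u'' -> ae_eq01 f u ->
  ae_eq01 (fun x => (k ^+ 2)%:C * f x) (fun x => - u'' x) ->
  forall x : R, 0 <= x <= 1 ->
    u x = u 0 * (cos (k * x))%:C + u' 0 * (sin (k * x) / k)%:C /\
    u' x = u' 0 * (cos (k * x))%:C - u 0 * (k * sin (k * x))%:C.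
Proof.
move=> k0 [uW u'W] fu fu'' x x01.
have [br bi] := in_L2_integrable uW.1; have [cr ci] := in_L2_integrable u'W.1.
have [abr abi] := in_W12_primitive01 uW.
have [bcr bci] := in_W12_primitive01 u'W.
have u''E : {ae mu, forall x, I01 x -> u'' x = - (k ^+ 2)%:C * u x}.
  apply: (@filterS2 _ _ (ae_filter_ringOfSetsType mu)) fu fu'' => y.
  move=> fuy fuy'' y01.
  by rewrite mulNr -fuy// fuy''// opprK.
have [|Ru Ru'] := edge_ode_real k0 br cr abr bcr _ x x01.
  apply: (@filterS _ _ (ae_filter_ringOfSetsType mu)) u''E => y uy /uy ->.
  by case: (u y) => ? ? /=; ring.
have [|Iu Iu'] := edge_ode_real k0 bi ci abi bci _ x x01.
  apply: (@filterS _ _ (ae_filter_ringOfSetsType mu)) u''E => y uy /uy ->.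
  by case: (u y) => ? ? /=; ring.
move: Ru Ru' Iu Iu'; case: (u x) => ? ?; case: (u' x) => ? ?.
case: (u 0) => ? ?; case: (u' 0) => ? ? /= -> -> -> ->.
by split; apply/eqP; rewrite eq_complex /=; apply/andP; split; apply/eqP; field.
Qed.

End EdgeEquation.

(** * The coupling condition at a vertex of degree five *)

Section SpectralEstimate.
Variable R : realType.
Import ComplexField.Normc.

Lemma normc_ge0 (z : R[i]) : 0 <= normc z.
Proof. by case: z => x y; exact: sqrtr_ge0. Qed.

Lemma normc_real (x : R) : normc x%:C = `|x|.
Proof. by rewrite /normc /= expr0n addr0 sqrtr_sqr. Qed.

(** In the alternating sum of the five rows starting at [m], neighbouring derivatives cancel. As 5
    is odd, the first and last rows have the same sign, so [psi' m] survives with factor 2. *)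
Lemma cyclic_coupling_solved (psi psi' : 'I_5 -> R[i]) :
  vertex_condition (cyclic_matrix R 5) (\col_m psi m) (\col_m psi' m) ->
  forall m : 'I_5, psi' m =
    'i * (psi (ordS m) - psi (ordS (ordS m)) + psi (ordS (ordS (ordS m)))
          - psi (ordS (ordS (ordS (ordS m))))).
Proof.
move=> cond.
have rowE (f : 'I_5 -> R[i]) m :
    (cyclic_matrix R 5 *m \col_m f m) m ord0 = f (ordS m).
  rewrite mxE (bigD1 (ordS m))//= big1 ?addr0; last first.
    by move=> i /negbTE im; rewrite !mxE im mul0r.
  by rewrite !mxE eqxx mul1r.
have E m : psi (ordS m) - psi m + 'i * (psi' (ordS m) + psi' m) = 0.
  have := congr1 (fun A : 'cV_5 => A m ord0) cond.
  have addE (A B : 'cV[R[i]]_5) :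
    (A + B) m ord0 = A m ord0 + B m ord0 by rewrite mxE.
  have oppE (A : 'cV[R[i]]_5) : (- A) m ord0 = - A m ord0 by rewrite mxE.
  have scaleE a (A : 'cV[R[i]]_5) :
    (a *: A) m ord0 = a * A m ord0 by rewrite mxE.
  by rewrite mulmxBl mulmxDl !mul1mx !addE oppE scaleE !addE !rowE !mxE.
move=> m.
have m5 : ordS (ordS (ordS (ordS (ordS m)))) = m.
  by apply: val_inj; case: m => [[|[|[|[|[|]]]]]].
have E0 := E m; have E1 := E (ordS m); have E2 := E (ordS (ordS m)).
have E3 := E (ordS (ordS (ordS m))); have := E (ordS (ordS (ordS (ordS m)))).
rewrite m5 => E4.
have i2 : 'i * 'i = -1 :> R[i] by rewrite -expr2 sqr_i.
move: E0 E1 E2 E3 E4; set m1 := ordS m; set m2 := ordS m1.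
set m3 := ordS m2; set m4 := ordS m3 => E0 E1 E2 E3 E4.
set T := psi _ - _ + _ - _.
have : 2 * ('i * psi' m + T) = 0 :> R[i].
  have -> : 2 * ('i * psi' m + T)
    = (psi m1 - psi m + 'i * (psi' m1 + psi' m))
      - (psi m2 - psi m1 + 'i * (psi' m2 + psi' m1))
      + (psi m3 - psi m2 + 'i * (psi' m3 + psi' m2))
      - (psi m4 - psi m3 + 'i * (psi' m4 + psi' m3))
      + (psi m - psi m4 + 'i * (psi' m + psi' m4)) by rewrite /T; ring.
  by rewrite E0 E1 E2 E3 E4; ring.
move=> /eqP; rewrite mulf_eq0 pnatr_eq0 /= addrC addr_eq0 => /eqP ->.
by rewrite mulrN mulrA i2 mulN1r opprK.
Qed.

Lemma cyclic_coupling_bound (psi psi' : 'I_5 -> R[i]) (M : R) :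
  vertex_condition (cyclic_matrix R 5) (\col_m psi m) (\col_m psi' m) ->
  (forall m, normc (psi m) <= M) -> forall m, normc (psi' m) <= 4 * M.
Proof.
move=> /cyclic_coupling_solved E psiM m; rewrite E normcM.
have -> : normc ('i : R[i]) = 1 by rewrite /normc expr0n expr1n add0r sqrtr1.
rewrite mul1r; set a := psi (ordS m); set b := psi (ordS (ordS m)).
set c := psi _; set d := psi _.
have := le_normcD (a - b + c) (- d); have := le_normcD (a - b) c.
have := le_normcD a (- b); rewrite !normcN.
have := psiM (ordS m).
have := psiM (ordS (ordS m)).
have := psiM (ordS (ordS (ordS m))).
have := psiM (ordS (ordS (ordS (ordS m)))).
lra.
Qed.

(** * End points of an edge and the estimate along it *)

(** The vertex [w] is the end [x = 1]. It differs from [src e] because adjacent vertices have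
    distance 1, so there are no loops and the test [src e == v] tells the two ends apart. *)
Lemma edge_endpoints (src : edge R -> vertex) : orientation src ->
  forall e, exists w,
    w != src e /\ forall v, incident v e = (v == src e) || (v == w).
Proof.
move=> hsrc e; have := hsrc e; rewrite /incident.
have /existsP[a /existsP[b /andP[ab /eqP eE]]] := valP e.
have a_b : a != b.
  apply: contraTneq ab => ->; rewrite /adjacent_vertices /eucl_dist.
  rewrite big1 ?sqrtr0 1?eq_sym ?oner_eq0// => i _.
  by rewrite subrr expr0n.
rewrite [val e]eE !inE => /orP[/eqP->|/eqP->].
  by exists b; rewrite eq_sym; split=> // v; rewrite !inE.
by exists a; split=> // v; rewrite !inE orbC.
Qed.

(** Here [c] and [s] stand for [cos k] and [sin k], and [p] for a boundary value of largest modulus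
    in the whole graph, so that [4 * normc p] bounds the derivatives at both ends. Adding [c] times
    the first equation to the second eliminates [q]. *)
Lemma edge_estimate (k c s M : R) (p q P Q : R[i]) :
  0 < k -> s != 0 -> c ^+ 2 + s ^+ 2 = 1 ->
  0 < normc p -> normc P <= 4 * normc p -> normc Q <= 4 * normc p ->
  k%:C * (q - p * c%:C) = s%:C * P ->
  k%:C * (p - q * c%:C) = s%:C * Q ->
  k * `|s| <= 4 * (1 + `|c|).
Proof.
move=> k0 s0 cs p0 Pp Qp Pe Qe.
have : s%:C * (k%:C * p * s%:C) = s%:C * (Q + c%:C * P).
  have -> : s%:C * (k%:C * p * s%:C) = k%:C * p * (1 - c ^+ 2)%:C.
    by rewrite -cs addrAC subrr add0r rmorphXn /=; ring.
  have -> : (1 - c ^+ 2)%:C = 1 - c%:C ^+ 2 by rewrite rmorphB rmorph1 rmorphXn.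
  by rewrite [RHS]mulrDr -Qe mulrCA -Pe; ring.
have sC0 : s%:C != 0 by apply: contra_neq s0 => /complexI.
move=> /(mulfI sC0) /(congr1 (@normc R)).
rewrite !normcM !normc_real (gtr0_norm k0) => e.
have : normc (Q + c%:C * P) <= normc Q + `|c| * normc P.
  by apply: le_trans (le_normcD _ _) _; rewrite normcM normc_real.
rewrite -e => h.
rewrite -(ler_pM2r p0).
have := normr_ge0 c; nra.
Qed.

(** * From the trigonometric inequality to the distance from a multiple of [pi] *)

(** This is [x <= tan x] without division: [sin y - y * cos y] vanishes at 0 and has derivative
    [y * sin y], nonnegative on the interval. *)
Lemma mul_cos_le_sin (x : R) : 0 <= x <= pi / 2 -> x * cos x <= sin x.
Proof.
move=> /andP[x0 xpi].
pose f (y : R) := sin y - y * cos y.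
have df (y : R) : is_derive y 1 f (y * sin y).
  by apply: is_derive_eq; rewrite /GRing.scale/=; ring.
have fc : continuous f.
  by move=> y; apply/differentiable_continuous/derivable1_diffP.
have [c /itvP cx] := MVT_segment x0 (fun y _ => df y) (continuous_subspaceT fc).
rewrite /f mul0r sin0 !subr0 -subr_ge0 => ->.
rewrite !mulr_ge0 ?cx// sin_ge0_pi// cx/=.
apply: le_trans (le_trans xpi _); rewrite ?cx//.
by rewrite ler_pdivrMr// ler_peMr ?pi_ge0// ler1n.
Qed.

Lemma near_pi_multiple (k : R) : 0 < k ->
  k * `|sin k| <= 4 * (1 + `|cos k|) ->
  exists n : nat, `|k - n%:R * pi| <= 8 / k.
Proof.
move=> k0 H; have pi0 := pi_gt0 R.
(* Adding 1/2 before truncating rounds [k / pi] to a nearest integer, whence [|d| <= pi / 2]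
   below. *)
pose n := Num.truncn (k / pi + 1 / 2).
have /andP[n1 n2] : n%:R <= k / pi + 1 / 2 < n.+1%:R.
  by apply: truncn_itv; rewrite addr_ge0 ?divr_ge0 ?ltW.
exists n; pose d := k - n%:R * pi.
have kE : k = d + pi *+ n by rewrite /d -mulr_natl; ring.
have kpi : k = k / pi * pi by rewrite divfK// gt_eqF.
have dpi : `|d| <= pi / 2.
  have -> : d = (k / pi - n%:R) * pi by rewrite mulrBl -kpi.
  rewrite normrM (gtr0_norm pi0) mulrC ler_pM2l// ler_norml.
  move: n1 n2; rewrite -[n.+1%:R]natr1; move: (n%:R) (k / pi) => x y n1 n2.
  by apply/andP; split; lra.
have sE : `|sin k| = `|sin d|.
  by rewrite kE (alternatingn (@sinDpi R)) normrM normrX normrN1 expr1n mul1r.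
have cE : `|cos k| = `|cos d|.
  by rewrite kE (alternatingn (@cosDpi R)) normrM normrX normrN1 expr1n mul1r.
(* In the half angle, [|sin d| = 2 sin h cos h] and, as [cos d >= 0], [1 + |cos d| = 2 cos^2 h].
   Cancelling [2 cos h > 0] leaves [k sin h <= 4 cos h]. *)
pose h := `|d| / 2.
have h0 : 0 <= h by rewrite divr_ge0.
have h1 : h <= pi / 4 by rewrite /h; lra.
have dh : `|d| = h *+ 2 by rewrite /h -mulr_natr divfK.
have sE' : `|sin d| = (cos h * sin h) *+ 2.
  rewrite -sin_mulr2n -dh.
  have sd : 0 <= sin `|d|.
    by rewrite sin_ge0_pi// normr_ge0 (le_trans dpi)//; lra.
  rewrite -(ger0_norm sd); have [d0|d0] := leP 0 d.
    by rewrite (ger0_norm d0).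
  by rewrite (ltr0_norm d0) sinN normrN.
have cE' : `|cos d| = cos h ^+ 2 *+ 2 - 1.
  rewrite -cos_mulr2n -dh cos_norm ger0_norm// cos_ge0_pihalf//.
  by rewrite -ler_norml.
have ch : 0 < cos h by apply: cos_gt0_pihalf; apply/andP; split; lra.
have hs : h * cos h <= sin h by apply: mul_cos_le_sin; rewrite h0/=; lra.
have ks : k * sin h <= 4 * cos h.
  rewrite -(ler_pM2l ch); move: H; rewrite sE cE sE' cE'; lra.
have kh : k * h <= 4.
  by rewrite -(ler_pM2r ch); apply: le_trans ks; rewrite -mulrA ler_pM2l.
by rewrite -/d dh ler_pdivlMr//; lra.
Qed.

(** * The estimate for an eigenvalue of the graph *)

(** Exchanging the two ends exchanges the two relations, so [v] may be either end and the direction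
    of the edge drops out. *)
Lemma edge_boundary_relation (src : edge R -> vertex)
    (u u' : edge R -> R -> R[i]) (k : R) (v : vertex) (e : edge R) :
  orientation src -> k != 0 -> incident v e ->
  u e 1 = u e 0 * (cos k)%:C + u' e 0 * (sin k / k)%:C ->
  u' e 1 = u' e 0 * (cos k)%:C - u e 0 * (k * sin k)%:C ->
  let bv := boundary_value src u in let od := outgoing_derivative src u' in
  exists w, [/\ incident w e,
    k%:C * (bv w e - bv v e * (cos k)%:C) = (sin k)%:C * od v e &
    k%:C * (bv v e - bv w e * (cos k)%:C) = (sin k)%:C * od w e].
Proof.
move=> hsrc k0 ve u1 u'1 bv od.
have [w [ws ew]] := edge_endpoints src hsrc e.
have sw : src e == w = false by rewrite eq_sym (negbTE ws).
have kC : k%:C != 0 by apply: contra_neq k0 => /complexI.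
have cs : (cos k)%:C ^+ 2 = 1 - (sin k)%:C ^+ 2 :> R[i].
  by rewrite -!rmorphXn /= cos2sin2 rmorphB.
have r1 :
    k%:C * (bv w e - bv (src e) e * (cos k)%:C) = (sin k)%:C * od (src e) e.
  rewrite /bv /od /boundary_value /outgoing_derivative sw eqxx u1.
  rewrite rmorphM fmorphV /=.
  by field.
have r2 :
    k%:C * (bv (src e) e - bv w e * (cos k)%:C) = (sin k)%:C * od w e.
  rewrite /bv /od /boundary_value /outgoing_derivative sw eqxx u1 u'1.
  rewrite !rmorphM fmorphV /=.
  rewrite mulrDl -[X in _ - (X + _)]mulrA -expr2 cs.
  by field.
move: ve; rewrite ew => /orP[] /eqP->.
  by exists w; rewrite ew eqxx orbT.
by exists (src e); rewrite ew eqxx.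
Qed.

Lemma eigenvalue_estimate (src : edge R -> vertex)
    (num : vertex -> 'I_5 -> edge R) (k : R) :
  orientation src -> clockwise_numbering num -> 0 < k ->
  eigenvalue_of_H src num (k ^+ 2)%:C -> k * `|sin k| <= 4 * (1 + `|cos k|).
Proof.
move=> hsrc hnum k0 [f [fneq0 [u [u' [u'' [fu uW cpl fu'']]]]]].
(* If [sin k = 0], the left side of the estimate vanishes; otherwise [sin k] can be cancelled
   later. *)
have [s0|s0] := eqVneq (sin k) 0.
  by rewrite s0 normr0 mulr0 mulr_ge0// addr_ge0.
have kN0 : k != 0 by rewrite gt_eqF.
have ode e := edge_ode R k _ _ _ _ kN0 (uW e) (fu e) (fu'' e).
have inc v e : incident v e <-> exists m, num v m = e.
  by have [_ + _] := hnum v; apply.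
pose bv := boundary_value src u; pose od := outgoing_derivative src u'.
pose N (x : vertex * 'I_5) := normc (bv x.1 (num x.1 x.2)).
(* The maximum runs over all pairs of a vertex and an edge number there, so it bounds the data at
   every vertex at once. *)
pose x0 := [arg max_(x > ((ord0, true, true), ord0)) N x]%O.
have Nmax x : N x <= N x0.
  by rewrite /x0; case: arg_maxP => // y _; apply.
have odmax v m : normc (od v (num v m)) <= 4 * N x0.
  apply: cyclic_coupling_bound (cpl v) _ m => m.
  exact: (Nmax (v, m)).
(* If all boundary values vanish, the coupling makes the derivatives vanish too. Then [u] has zero
   initial data on every edge, so [f] is zero almost everywhere, a contradiction. *)
have [N0|N0] := eqVneq (N x0) 0.
  exfalso; apply: fneq0 => e.
  have [m me] := (inc (src e) e).1 (hsrc e).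
  have u0 : u e 0 = 0.
    have := Nmax (src e, m); rewrite N0 /N /= me /bv /boundary_value eqxx => h.
    by apply: eq0_normc; apply/eqP; rewrite eq_le h normc_ge0.
  have u'0 : u' e 0 = 0.
    have := odmax (src e) m; rewrite N0 mulr0 me.
    rewrite /od /outgoing_derivative eqxx => h.
    by apply: eq0_normc; apply/eqP; rewrite eq_le h normc_ge0.
  apply: (@filterS _ _ (ae_filter_ringOfSetsType _)) (fu e) => x fux x01.
  rewrite fux// (ode e x _).1 ?u0 ?u'0 ?mul0r ?addr0//.
  by move: x01; rewrite /= in_itv/= => /andP[/ltW-> /ltW].
have Ngt0 : 0 < N x0.
  by rewrite lt_neqAle eq_sym N0 normc_ge0.
set v := x0.1; set e := num v x0.2.
have ve : incident v e by apply/inc; exists x0.2.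
have [|] := ode e 1; first by rewrite ler01 lexx.
rewrite !mulr1 => u1 u'1.
have [w [we r1 r2]] := edge_boundary_relation src u u' k v e hsrc kN0 ve u1 u'1.
(* The edge also has a number at its other end [w], so the derivative there obeys the same global
   bound. *)
have [m me] := (inc w e).1 we.
apply: (edge_estimate k (cos k) (sin k)) r1 r2 => //.
- exact: cos2Dsin2.
- exact: odmax.
- by have := odmax w m; rewrite me.
Qed.

End SpectralEstimate.

Theorem theorem7p1 (R : realType)
    (src : edge R -> vertex) (hsrc : orientation src)
    (num : vertex -> 'I_5 -> edge R) (hnum : clockwise_numbering num) :
  exists C K : R, 0 < C /\ 0 < K /\
    forall k : R, K <= k -> eigenvalue_of_H src num ((k ^+ 2)%:C) ->
      exists n : int,
        `|k - n%:~R * pi| < (1084 / 100) / k + C / k ^+ 2.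
Proof.
(* Since [8 / k < 10.84 / k] for [k > 0], any positive constants would do; [K = 1] only ensures
   [k > 0]. *)
exists 1, 1; do 2 split => //; move=> k k1 /eigenvalue_estimate H.
have k0 : 0 < k by apply: lt_le_trans k1.
have [n kn] := near_pi_multiple R k k0 (H hsrc hnum k0).
exists n; rewrite pmulrn; apply: le_lt_trans kn _.
rewrite -[ltLHS]addr0 ltrD// ?ltr_pM2r ?invr_gt0//; first lra.
by rewrite divr_gt0// exprn_gt0.
Qed.
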